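(* Let $H$ be a discretely valued hyperfield which is not a field. Then $\mathrm{Tr}(H)=(R,M,\epsilon)$ is a triple: $R$ is a truncated DVR, $M$ is a free $R$-module of rank $1$, and $\epsilon:M\to R$ is an $R$-linear map whose image is the maximal ideal of $R$.
   Context: A hyperfield is a set $H$ with a multivalued addition $+:H\times H\to 2^H$ and a single-valued multiplication such that: $(x+y)+z=x+(y+z)$ for all $x,y,z$, where $(x+y)+z:=\bigcup_{t\in x+y}(t+z)$ and similarly on the right; $x+y=y+x$; there is $0\in H$ with $x+0=\{x\}$ for all $x$; for every $x$ there is a unique $-x$ with $0\in x+(-x)$; $x\in y-z$ iff $y\in x+z$ (where $y-z:=y+(-z)$); multiplication is commutative, associative, unital, with $(x+y)z\subseteq xz+yz$; $0\neq 1$ and every nonzero element is invertible. A hyperfield ''is a field'' if all its sums are singletons. A valued hyperfield is a hyperfield with a map $|\cdot|:H\to\mathbb{R}$ such that (i) $|x|\ge0$ with equality iff $x=0$; (ii) $|xy|=|x||y|$; (iii) $|z|\le\max(|x|,|y|)$ for all $z\in x+y$; (iv) $|\cdot|$ is constant on $x+y$ unless $0\in x+y$ (this gives a metric $d(x,y)=|z|$ for any $z\in x-y$ when $x\neq y$, $d(x,x)=0$); (v) there is a real $\rho>0$ such that either $x+y$ is a closed ball of radius $\rho\max(|x|,|y|)$ for all $x,y$, or $x+y$ is an open ball of radius $\rho\max(|x|,|y|)$ for all $x,y$; the smallest such $\rho$ is denoted $\rho_H$. $H$ is discretely valued if $0$ is the only non-isolated point of $\{|x|:x\in H\}$. For such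 $H$ not a field, $\theta_H$ is the smallest element of $\{|x|:x\neq0\}$ less than $1$; $\mathcal{O}_H$ is the closed ball of radius $1$ about $0$ and $\mathfrak{m}_H^k$ the closed ball of radius $\theta_H^k$ about $0$. A truncated DVR is a local Artinian ring whose maximal ideal is principal. Construction of $\mathrm{Tr}(H)$: for $i\in\mathbb{Z}$ let $M_i=\mathfrak{m}_H^i/\!\sim$ where $x\sim y$ iff $d(x,y)\le\rho_H\theta_H^i$, with addition defined by letting the sum of the classes of $\hat x,\hat y$ be the class of any element of $\hat x+\hat y$, and multiplication $M_i\times M_j\to M_{i+j}$ given by multiplying lifts. Put $R=M_0$ (a ring) and $M=M_1$ (an $R$-module); $\epsilon:M\to R$ sends the class of $\hat x\in\mathfrak{m}_H$ to the class of $\hat x\in\mathcal{O}_H$ in $R$. $\mathrm{Tr}(H)=(R,M,\epsilon)$.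
   Formalization: θ_H is taken as the largest (not ''smallest'') element of {|x|: x≠0} less than 1, since no smallest one exists when 0 is non-isolated; the open-ball alternative in (v) is required only for (x,y)≠(0,0), as an open ball of radius 0 is empty. *)

(* Defs.v *)
From HB Require Import structures.
From mathcomp Require Import all_boot all_order all_algebra generic_quotient.
From mathcomp Require Import boolp classical_sets reals topology normedtype.

Set Implicit Arguments.
Unset Strict Implicit.
Unset Printing Implicit Defensive.

Import Order.TTheory GRing.Theory Num.Theory.
Import numFieldNormedType.Exports.
Local Open Scope classical_set_scope.
Local Open Scope ring_scope.
Local Open Scope quotient_scope.

Reserved Notation "x +h y" (at level 50, left associativity).
Reserved Notation "x -h y" (at level 50, left associativity).
Reserved Notation "x *h y" (at level 40, left associativity).

HB.mixin Record isHyperfield (H : Type) & Choice H := {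
  hzero : H;
  hone : H;
  hopp : H -> H;
  hadd : H -> H -> set H;
  hmul : H -> H -> H;
  haddA : forall x y z,
    \bigcup_(t in hadd x y) hadd t z = \bigcup_(t in hadd y z) hadd x t;
  haddC : forall x y, hadd x y = hadd y x;
  haddx0 : forall x, hadd x hzero = [set x];
  hopp_unique : forall x y, hadd x y hzero <-> y = hopp x;
  hadd_reversible : forall x y z, hadd y (hopp z) x <-> hadd x z y;
  hmulC : commutative hmul;
  hmulA : associative hmul;
  hmul1x : left_id hone hmul;
  hmulDl_sub : forall x y z,
    [set hmul t z | t in hadd x y] `<=` hadd (hmul x z) (hmul y z);
  hzero_neq_one : hzero <> hone;
  hinv_exists : forall x, x <> hzero -> exists y, hmul x y = hone
}.

#[short(type="hyperfieldType")]
HB.structure Definition Hyperfield := {H of Choice H & isHyperfield H}.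

Arguments hzero {_}.
Arguments hone {_}.

Notation "x +h y" := (hadd x y).
Notation "x -h y" := (hadd x (hopp y)).
Notation "x *h y" := (hmul x y).

Definition hyperfield_is_field (H : hyperfieldType) : Prop :=
  forall x y : H, exists z, x +h y = [set z].

Section Metric.
Variables (K : realType) (H : hyperfieldType) (v : H -> K).

(* [hdistE] below: for x <> y every element of x - y gives the same value. *)
Definition dist_of (x y : H) : K :=
  if x == y then 0 else v (xget hzero (x -h y)).

Definition cball_of (c : H) (r : K) : set H := [set z | dist_of z c <= r].

Definition oball_of (c : H) (r : K) : set H := [set z | dist_of z c < r].

(* An open ball of radius 0 is empty whereas 0 + 0 = {0}, so the open
   alternative can only be asked of pairs (x, y) other than (0, 0). *)
Definition sums_are_balls (rho : K) : Prop :=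
  (forall x y, exists c, x +h y = cball_of c (rho * Num.max (v x) (v y))) \/
  (forall x y, ~ (x = hzero /\ y = hzero) ->
     exists c, x +h y = oball_of c (rho * Num.max (v x) (v y))).

End Metric.

HB.mixin Record isValued (K : realType) (H : Type) & Hyperfield H := {
  hval : H -> K;
  hval_ge0 : forall x, 0 <= hval x;
  hval_eq0 : forall x, hval x = 0 <-> x = hzero;
  hvalM : forall x y, hval (x *h y) = hval x * hval y;
  hval_ultra : forall x y z, (x +h y) z -> hval z <= Num.max (hval x) (hval y);
  hval_constant : forall x y, ~ (x +h y) hzero ->
    forall z t, (x +h y) z -> (x +h y) t -> hval z = hval t;
  hval_balls : exists2 rho, 0 < rho & sums_are_balls hval rho
}.

#[short(type="valuedHyperfieldType")]
HB.structure Definition ValuedHyperfield (K : realType) :=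
  {H of Hyperfield H & isValued K H}.

HB.mixin Record isDiscretelyValued (K : realType) (H : Type)
    & ValuedHyperfield K H := {
  hval_discrete :
    range (hval : H -> K) `\` isolated (range (hval : H -> K)) = [set 0]
}.

#[short(type="discreteHyperfieldType")]
HB.structure Definition DiscreteHyperfield (K : realType) :=
  {H of ValuedHyperfield K H & isDiscretelyValued K H}.

Section Invariants.
Variables (K : realType) (H : valuedHyperfieldType K).

Definition hdist (x y : H) : K := dist_of hval x y.

(* The default 0 is never reached when H is discretely valued:
   see [rho_ofP] and [theta_ofP]. *)
Definition rho_of : K :=
  let A := [set rho : K | 0 < rho /\ sums_are_balls (hval : H -> K) rho] in
  xget 0 [set m | A m /\ lbound A m].

(* The largest value below 1: since the values accumulate at 0, those below 1
   have no smallest element. *)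
Definition theta_of : K :=
  let A := [set hval x | x in [set x : H | x <> hzero /\ hval x < 1]] in
  xget 0 [set m | A m /\ ubound A m].

End Invariants.

Arguments rho_of {K} H.
Arguments theta_of {K} H.

Section ValuedTheory.
Variables (K : realType) (H : valuedHyperfieldType K).
Implicit Types x y z c : H.

Lemma hadd_asso x y z s t : (x +h y) t -> (t +h z) s ->
  exists2 u, (y +h z) u & (x +h u) s.
Proof.
move=> h1 h2; have : (\bigcup_(t in x +h y) (t +h z)) s by exists t.
by rewrite haddA => -[u ? ?]; exists u.
Qed.

Lemma hadd_asso' x y z s u : (y +h z) u -> (x +h u) s ->
  exists2 t, (x +h y) t & (t +h z) s.
Proof.
move=> h1 h2; have : (\bigcup_(t in y +h z) (x +h t)) s by exists u.
by rewrite -haddA => -[t ? ?]; exists t.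
Qed.

Lemma hsub0 x : (x -h x) hzero.
Proof. by apply/hopp_unique. Qed.

Lemma hoppK x : hopp (hopp x) = x.
Proof. by symmetry; apply/hopp_unique; rewrite haddC; exact: hsub0. Qed.

Lemma hopp0 : hopp (hzero : H) = hzero.
Proof. by symmetry; apply/hopp_unique; rewrite haddx0. Qed.

Lemma hadd_neq0 x y : (x +h y) !=set0.
Proof.
have h1 : (x +h hzero) x by rewrite haddx0.
by have [t ? _] := hadd_asso' (hsub0 y) h1; exists t.
Qed.

Lemma hsub_eq0 x y : (x -h y) hzero -> x = y.
Proof. by move=> /hopp_unique e; rewrite -(hoppK x) -e hoppK. Qed.

Lemma hsubC x y z : (x -h y) z -> (y -h x) (hopp z).
Proof.
move=> /hadd_reversible; rewrite haddC => /hadd_reversible h.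
by apply/hadd_reversible; rewrite haddC.
Qed.

Lemma hval0 : hval (hzero : H) = 0 :> K.
Proof. by apply/hval_eq0. Qed.

Lemma hval_gt0 x : x <> hzero -> 0 < hval x :> K.
Proof.
by move=> x0; rewrite lt0r hval_ge0 andbT; apply/eqP => /hval_eq0.
Qed.

Lemma hval1 : hval (hone : H) = 1 :> K.
Proof.
have h : hval (hone : H) != 0 :> K.
  by apply/eqP => /hval_eq0 e; apply: (@hzero_neq_one H); rewrite e.
by apply: (mulfI h); rewrite -hvalM hmul1x mulr1.
Qed.

Lemma hmul0x x : hzero *h x = hzero.
Proof. by apply/hval_eq0; rewrite hvalM hval0 mul0r. Qed.

Lemma hmulN x y : hopp x *h y = hopp (x *h y).
Proof.
apply/hopp_unique; rewrite -(hmul0x y); apply: hmulDl_sub.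
by exists hzero => //; exact: hsub0.
Qed.

Lemma hvalN x : hval (hopp x) = hval x :> K.
Proof.
have e : hval (hopp (hone : H)) = 1 :> K.
  apply/eqP; rewrite -(@pexpr_eq1 _ _ 2) ?hval_ge0//.
  by rewrite expr2 -hvalM hmulN hmul1x hoppK hval1.
by rewrite -[in LHS](hmul1x x) -hmulN hvalM e mul1r.
Qed.

Lemma hdistE x y z : x <> y -> (x -h y) z -> hdist x y = hval z.
Proof.
move=> xy h; rewrite /hdist /dist_of; case: eqP => // _.
apply: (@hval_constant _ _ x (hopp y)) => //; first by move/hsub_eq0.
by case: xgetP => // /(_ z).
Qed.

Lemma hdist_le x y z : (x -h y) z -> hdist x y <= hval z.
Proof.
move=> h; have [->|/eqP xy] := eqVneq x y.
  by rewrite /hdist /dist_of eqxx hval_ge0.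
by rewrite (hdistE xy h).
Qed.

Lemma hdist_ex x y : exists2 z, (x -h y) z & hdist x y = hval z.
Proof.
have [->|/eqP xy] := eqVneq x y.
  exists hzero; first exact: hsub0.
  by rewrite /hdist /dist_of eqxx hval0.
by have [z h] := hadd_neq0 x (hopp y); exists z => //; exact: hdistE.
Qed.

Lemma hdistxx x : hdist x x = 0.
Proof. by rewrite /hdist /dist_of eqxx. Qed.

Lemma hdist_ge0 x y : 0 <= hdist x y.
Proof. by have [z _ ->] := hdist_ex x y; rewrite hval_ge0. Qed.

Lemma hdistC x y : hdist x y = hdist y x.
Proof.
have h (a b : H) : hdist a b <= hdist b a.
  by have [z /hsubC h ->] := hdist_ex b a; rewrite -hvalN; exact: hdist_le.
by apply/eqP; rewrite eq_le !h.
Qed.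

Lemma hdistx0 x : hdist x hzero = hval x.
Proof. by have [z] := hdist_ex x hzero; rewrite hopp0 haddx0 => ->. Qed.

Lemma hdist_ultra y x z r : hdist x y <= r -> hdist y z <= r -> hdist x z <= r.
Proof.
have [u xyu ->] := hdist_ex x y; have [w yzw ->] := hdist_ex y z => ur wr.
have /hadd_reversible xuy := xyu; have /hadd_reversible ywz := yzw.
rewrite haddC in xuy.
have : exists2 t, (u +h w) t & (t +h z) x.
  by apply: hadd_asso' ywz _; rewrite haddC.
move=> [t uwt tz].
have h : hdist x z <= hval t by apply: hdist_le; apply/hadd_reversible.
by apply: le_trans h _; apply: le_trans (@hval_ultra K H _ _ _ uwt) _; rewrite ge_max ur.
Qed.

Lemma hdistM x y z : hdist (x *h z) (y *h z) <= hdist x y * hval z.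
Proof.
have [u h ->] := hdist_ex x y; rewrite -hvalM; apply: hdist_le.
by rewrite -hmulN; apply: hmulDl_sub; exists u.
Qed.

Lemma hadd_shift x x' y z : (x +h y) z ->
  exists2 s, (x' +h y) s & hdist z s <= hdist x x'.
Proof.
have [u /hadd_reversible xu ->] := hdist_ex x x' => xyz.
have [s h1 h2] := hadd_asso xu xyz.
by exists s => //; apply: hdist_le; apply/hadd_reversible.
Qed.

Lemma hval_inv x : x <> hzero ->
  exists2 y : H, y <> hzero & hval y = (hval x)^-1 :> K.
Proof.
move=> x0; have [y xy] := hinv_exists _ x0.
have e : hval x * hval y = 1 :> K by rewrite -hvalM xy hval1.
exists y.
  by move=> y0; move: e; rewrite y0 hval0 mulr0 => /eqP; rewrite eq_sym oner_eq0.
by apply: (mulfI (lt0r_neq0 (hval_gt0 x0))); rewrite e divff// lt0r_neq0// hval_gt0.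
Qed.

Lemma hmul_neq0 x y : x <> hzero -> y <> hzero -> x *h y <> hzero.
Proof.
move=> x0 y0 /hval_eq0; rewrite hvalM => /eqP.
by rewrite mulf_eq0 !gt_eqF// hval_gt0.
Qed.

Lemma theta_of_ge0 : 0 <= theta_of H.
Proof.
by rewrite /theta_of; case: xgetP => //= t _ [[x _ <-] _]; exact: hval_ge0.
Qed.

Lemma rho_of_ge0 : 0 <= rho_of H.
Proof. by rewrite /rho_of; case: xgetP => //= t _ [[/ltW]]. Qed.

(* The ball m_H^i; in particular m_H^0 = O_H. *)
Definition mpow (i : int) : pred H := fun x => hdist x hzero <= theta_of H ^ i.

Record mpow_of (i : int) := Mpow {mpow_val : H; _ : mpow i mpow_val}.

HB.instance Definition _ i := [isSub for @mpow_val i].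
HB.instance Definition _ i := [Choice of mpow_of i by <:].

Lemma mpowE i x : mpow i x = (hval x <= theta_of H ^ i).
Proof. by rewrite /mpow hdistx0. Qed.

Lemma mpow0 i : mpow i hzero.
Proof. by rewrite /mpow hdistxx exprz_ge0 ?theta_of_ge0. Qed.

Definition trunc_sim (i : int) : rel (mpow_of i) :=
  fun a b => hdist (val a) (val b) <= rho_of H * theta_of H ^ i.

Lemma trunc_sim_refl i : reflexive (@trunc_sim i).
Proof.
move=> x; rewrite /trunc_sim hdistxx mulr_ge0 ?rho_of_ge0//.
by rewrite exprz_ge0 ?theta_of_ge0.
Qed.

Lemma trunc_sim_sym i : symmetric (@trunc_sim i).
Proof. by move=> x y; rewrite /trunc_sim hdistC. Qed.

Lemma trunc_sim_trans i : transitive (@trunc_sim i).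
Proof. by move=> y x z; rewrite /trunc_sim; exact: hdist_ultra. Qed.

Canonical trunc_sim_equiv i := EquivRel (@trunc_sim i)
  (@trunc_sim_refl i) (@trunc_sim_sym i) (@trunc_sim_trans i).

End ValuedTheory.

Arguments mpow_of {K} H i.
Arguments mpow {K} H i.

Section DiscreteTheory.
Variables (K : realType) (H : discreteHyperfieldType K).
Implicit Types x y z c : H.

Local Notation hv := (hval : H -> K).

Lemma value_isolated (t : K) : range hv t -> t <> 0 ->
  exists2 e, 0 < e & forall x, `|t - hv x| < e -> hv x = t.
Proof.
move=> rt t0; have : isolated (range hv) t.
  apply: contrapT => nis.
  have : (range hv `\` isolated (range hv)) t by split.
  by rewrite hval_discrete.
move=> [_ [V Vt /seteqP[sV _]]].
have /nbhs_ballP[e /= e0 eV] := Vt.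
exists e => // x xe; apply: (sV (hv x)); split; last by exists x.
by apply: eV; rewrite /ball /=.
Qed.

Lemma small_value (e : K) : 0 < e -> exists2 x, x <> hzero & hv x < e.
Proof.
move=> e0; apply: contrapT => h.
have : (range hv `\` isolated (range hv)) 0 by rewrite hval_discrete.
move=> [_]; apply; split.
  by rewrite inE; exists hzero => //; exact: (@hval0 K H).
exists (ball (0 : K) e); first exact: nbhsx_ballx.
apply/seteqP; split=> [t [te [x _ xt]]|_ ->].
  move: te; rewrite -xt /ball /= sub0r normrN ger0_norm ?hval_ge0// => xe.
  have [->|/eqP x0] := eqVneq x hzero; first exact: hval0.
  by exfalso; apply: h; exists x.
split; first exact: ballxx.
by exists hzero => //; exact: (@hval0 K H).
Qed.

Lemma value_max (A : set K) : A !=set0 ->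
  (forall t, A t -> exists2 x, x <> hzero & hv x = t) ->
  has_ubound A -> exists2 t, A t & ubound A t.
Proof.
move=> A0 AV Au.
have [e0 e0_gt0 e0P] : exists2 e, 0 < e &
    forall x, `|1 - hv x| < e -> hv x = 1.
  by apply: value_isolated; [exists hone => //; exact: hval1|exact/eqP/oner_neq0].
have sA : has_sup A by split.
have s0 : 0 < sup A.
  have [t At] := A0; have [x x0 xt] := AV _ At.
  by apply: lt_le_trans (ub_le_sup Au At); rewrite -xt hval_gt0.
have [|a Aa aS] := @sup_adherent _ A (sup A * e0) _ sA; first exact: mulr_gt0.
exists a => // b Ab; rewrite leNgt; apply/negP => ab.
have [x x0 xa] := AV _ Aa; have [y y0 yb] := AV _ Ab.
have [y' _ y'E] := hval_inv y0.
have b0 : 0 < b by rewrite -yb hval_gt0.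
have bS : b <= sup A by exact: ub_le_sup.
have ab1 : a / b < 1 by rewrite ltr_pdivrMr// mul1r.
have : hv (x *h y') = 1.
  apply: e0P; rewrite hvalM y'E xa yb gtr0_norm ?subr_gt0//.
  rewrite ltrBlDr -ltrBlDl ltr_pdivlMr//.
  have [e1|e1] := leP 1 e0.
    apply: (@le_lt_trans _ _ 0); last by rewrite -xa hval_gt0.
    by rewrite mulr_le0_ge0 ?subr_le0// ltW.
  apply: le_lt_trans aS.
  have -> : sup A - sup A * e0 = (1 - e0) * sup A by rewrite mulrBl mul1r mulrC.
  by rewrite ler_pM2l// subr_gt0.
by move=> e; move: ab1; rewrite -yb -xa -y'E -hvalM e ltxx.
Qed.

Lemma theta_ofP : exists2 x,
  x <> hzero & hv x = theta_of H /\
    theta_of H < 1 /\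
    forall y, y <> hzero -> hv y < 1 -> hv y <= theta_of H.
Proof.
rewrite /theta_of; case: xgetP => [t _ [[x [x0 x1] <-] xub]|] /=.
  by exists x => //; split => //; split=> // y y0 y1; apply: xub; exists y.
set A := [set hval x | x in _] => noA; exfalso.
have [|||t At Atu] := @value_max A; last by apply: (noA t).
- by have [x x0 x1] := small_value ltr01; exists (hv x), x.
- by move=> _ [x [x0 _] <-]; exists x.
- by exists 1 => _ [x [_ /ltW]] /[swap] <-.
Qed.

Lemma theta_of_gt0 : 0 < theta_of H.
Proof. by have [x x0 [<- _]] := theta_ofP; exact: hval_gt0. Qed.

Definition closed_sums (t : K) : Prop :=
  forall x y, exists c, x +h y = cball_of hv c (t * Num.max (hv x) (hv y)).

Lemma sums_are_balls_closed (r : K) : 0 < r -> sums_are_balls hv r ->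
  exists2 x, x <> hzero & hv x <= r /\ closed_sums (hv x).
Proof.
have max_ge0 x y : 0 <= Num.max (hv x) (hv y) by rewrite le_max hval_ge0.
have mpos x y : Num.max (hv x) (hv y) <> 0 ->
    exists2 z, z <> hzero & hv z = Num.max (hv x) (hv y).
  move=> m0; exists (if hv x < hv y then y else x).
    by move=> e; apply: m0; rewrite /Order.max; case: ifP e => _ ->; rewrite hval0.
  by rewrite /Order.max; case: ifP.
have max_gt0 x y : Num.max (hv x) (hv y) <> 0 -> 0 < Num.max (hv x) (hv y).
  by move=> m0; rewrite lt0r max_ge0 andbT; apply/eqP.
have max_eq0 x y : Num.max (hv x) (hv y) = 0 -> x = hzero /\ y = hzero.
  move=> m0; split; apply/(@hval_eq0 K); apply/eqP; rewrite eq_le hval_ge0 andbT.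
    by rewrite -m0 le_max lexx.
  by rewrite -m0 le_max lexx orbT.
have main (P : pred K) : (forall s, 0 < s -> exists2 x, x <> hzero & hv x < s) ->
    P =1 (fun s => s <= r) \/ P =1 (fun s => s < r) -> 0 < r ->
    exists2 x, x <> hzero & P (hv x) /\
      forall z, z <> hzero -> P (hv z) -> hv z <= hv x.
  move=> small PE r0.
  have [|||_ [x [x0 Px] <-] xub] :=
      @value_max [set hv x | x in [set x | x <> hzero /\ P (hv x)]].
  - have [x x0 xr] := small _ r0; exists (hv x), x => //; split=> //.
    by case: PE => ->//; exact: ltW.
  - by move=> _ [x [x0 _] <-]; exists x.
  - by exists r => _ [x [_ +] <-]; case: PE => -> // /ltW.
  - by exists x => //; split=> // z z0 Pz; apply: xub; exists z.
move=> r0 [cl|op].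
- have [x x0 [xr xmax]] := main (fun s => s <= r) small_value (or_introl (frefl _)) r0.
  exists x => //; split=> // a b; have [c ->] := cl a b; exists c.
  have [/max_eq0[a0 b0]|/eqP m0] := eqVneq (Num.max (hv a) (hv b)) 0.
    by rewrite a0 b0 maxxx hval0 !mulr0.
  apply/seteqP; split=> z; rewrite /cball_of /=; last first.
    by move=> /le_trans; apply; rewrite ler_pM2r ?max_gt0.
  have [u _] := hdist_ex z c; rewrite /hdist => -> ur.
  have [w w0 wE] := mpos _ _ m0; have [w' w'0 w'E] := hval_inv w0.
  have [->|/eqP u0] := eqVneq u hzero.
    by rewrite hval0 mulr_ge0// hval_ge0.
  rewrite -ler_pdivrMr ?max_gt0// -wE -w'E -hvalM; apply: xmax.
    exact: hmul_neq0.
  by rewrite hvalM w'E wE ler_pdivrMr ?max_gt0.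
- have [x x0 [xr xmax]] := main (fun s => s < r) small_value (or_intror (frefl _)) r0.
  exists x => //; split=> [|a b]; first exact: ltW.
  have [m0|/eqP m0] := eqVneq (Num.max (hv a) (hv b)) 0.
    have [-> ->] := max_eq0 _ _ m0; exists hzero.
    rewrite maxxx hval0 mulr0 haddx0; apply/seteqP; split=> z; rewrite /cball_of /=.
      by move=> ->; rewrite [dist_of _ _ _]hdistxx.
    rewrite [dist_of _ _ _]hdistx0 => z0; apply/(@hval_eq0 K)/eqP.
    by rewrite eq_le z0 hval_ge0.
  have [|c ->] := op a b.
    by move=> [a0 b0]; apply: m0; rewrite a0 b0 maxxx hval0.
  exists c; apply/seteqP; split=> z; rewrite /cball_of /oball_of /=; last first.
    by move=> /le_lt_trans; apply; rewrite ltr_pM2r ?max_gt0.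
  have [u _] := hdist_ex z c; rewrite /hdist => -> ur.
  have [w w0 wE] := mpos _ _ m0; have [w' w'0 w'E] := hval_inv w0.
  have [->|/eqP u0] := eqVneq u hzero.
    by rewrite hval0 mulr_ge0// hval_ge0.
  rewrite -ler_pdivrMr ?max_gt0// -wE -w'E -hvalM; apply: xmax.
    exact: hmul_neq0.
  by rewrite hvalM w'E wE ltr_pdivrMr ?max_gt0.
Qed.

Lemma closed_sums_unique x y : closed_sums (hv x) -> closed_sums (hv y) ->
  hv x = hv y.
Proof.
have h a b : closed_sums (hv a) -> closed_sums (hv b) -> hv a <= hv b.
  move=> /(_ hone (hopp hone)) + /(_ hone (hopp hone)).
  rewrite hvalN hval1 maxxx !mulr1 => -[c ca] [d db].
  have ac : hdist hzero c <= hv a.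
    by have : cball_of hv c (hv a) hzero by rewrite -ca; exact: hsub0.
  have bd : hdist hzero d <= hv b.
    by have : cball_of hv d (hv b) hzero by rewrite -db; exact: hsub0.
  have : cball_of hv c (hv a) a.
    by rewrite /cball_of /= -/(hdist a c); apply: hdist_ultra ac; rewrite hdistx0.
  rewrite -ca db /cball_of /= -/(hdist a d) => ad.
  by rewrite -hdistx0; apply: hdist_ultra ad _; rewrite hdistC.
by move=> hx hy; apply/eqP; rewrite eq_le !h.
Qed.

Lemma rho_ofP : [/\ 0 < rho_of H, closed_sums (rho_of H),
  sums_are_balls hv (rho_of H) &
  forall r, 0 < r -> sums_are_balls hv r -> rho_of H <= r].
Proof.
have [r r0 rs] := @hval_balls K H.
have [x x0 [xr xc]] := sums_are_balls_closed r0 rs.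
have xmin : forall r', 0 < r' -> sums_are_balls hv r' -> hv x <= r'.
  move=> r' r'0 r's; have [y y0 [yr yc]] := sums_are_balls_closed r'0 r's.
  by rewrite (closed_sums_unique xc yc).
suff -> : rho_of H = hv x by split; rewrite ?hval_gt0//; left.
rewrite /rho_of; case: xgetP => [t _ [[t0 ts] tm]|] /=.
  apply/eqP; rewrite eq_le xmin// andbT; apply: tm; split; first exact: hval_gt0.
  by left.
move=> /(_ (hv x)) []; split; first by split; [exact: hval_gt0|left].
by move=> r' [r'0 r's]; exact: xmin.
Qed.

Lemma rho_of_lt1 : rho_of H < 1.
Proof.
have [_ cl _ _] := rho_ofP; have [y y0 y1] := small_value ltr01.
have n0 : ~ (hone +h y) hzero.
  by move=> /hopp_unique e; move: y1; rewrite e hvalN hval1 ltxx.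
have [c E] := cl hone y; rewrite hval1 max_l ?mulr1 in E; last exact: ltW.
have [z hz] := hadd_neq0 hone y.
have c0 : ~ hdist hzero c <= rho_of H.
  by move=> h; apply: n0; rewrite E.
have [z1 zc] : hv z <= 1 /\ hdist z c <= rho_of H.
  split; last by move: hz; rewrite E.
  by have := @hval_ultra K H _ _ _ hz; rewrite hval1 max_l// ltW.
rewrite ltNge; apply/negP => r1; apply: c0.
by apply: hdist_ultra zc; rewrite hdistC hdistx0 (le_trans z1).
Qed.

Lemma hadd_diam x y z t : (x +h y) z -> (x +h y) t ->
  hdist z t <= rho_of H * Num.max (hv x) (hv y).
Proof.
have [_ cl _ _] := rho_ofP; have [c ->] := cl x y.
by rewrite /cball_of /= => zc tc; apply: hdist_ultra zc _; rewrite hdistC.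
Qed.

End DiscreteTheory.

Section Truncation.
Variables (K : realType) (H : discreteHyperfieldType K).
Implicit Types (x y z : H) (i j : int).

Definition trunc i := {eq_quot (@trunc_sim K H i)}.

HB.instance Definition _ i := Choice.on (trunc i).
HB.instance Definition _ i := EqQuotient.on (trunc i).

Definition tlift i (a : trunc i) : H := val (repr a).

(* The class of [x]; only meaningful when [x] lies in m_H^i. *)
Definition tclass i x : trunc i :=
  \pi_(trunc i) (insubd (Mpow (mpow0 H i)) x).

Definition tzero i : trunc i := tclass i hzero.

(* Lifts are chosen here; [tclassN], [tclassD] and [tclassM] show that the
   results do not depend on the choices. *)
Definition topp i (a : trunc i) : trunc i := tclass i (hopp (tlift a)).

Definition tadd i (a b : trunc i) : trunc i :=
  tclass i (xget hzero (tlift a +h tlift b)).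

Definition tmul i j (a : trunc i) (b : trunc j) : trunc (i + j) :=
  tclass (i + j) (tlift a *h tlift b).

Lemma tlift_mpow i (a : trunc i) : mpow H i (tlift a).
Proof. by rewrite /tlift; case: (repr a). Qed.

Lemma tliftK i (a : trunc i) : tclass i (tlift a) = a.
Proof. by rewrite /tclass /tlift valKd reprK. Qed.

Lemma tclass_eq i x y : mpow H i x -> mpow H i y ->
  tclass i x = tclass i y <-> hdist x y <= rho_of H * theta_of H ^ i.
Proof.
move=> xi yi; rewrite /tclass; split=> [/eqP|h].
  by rewrite eqmodE /= /trunc_sim !insubdK.
by apply/eqP; rewrite eqmodE /= /trunc_sim !insubdK.
Qed.

Lemma tlift_tclass i x : mpow H i x ->
  hdist (tlift (tclass i x)) x <= rho_of H * theta_of H ^ i.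
Proof. by move=> xi; apply/tclass_eq; rewrite ?tliftK ?tlift_mpow. Qed.

Lemma tclass_surj i (a : trunc i) : exists2 x, mpow H i x & a = tclass i x.
Proof. by exists (tlift a); rewrite ?tliftK ?tlift_mpow. Qed.

Lemma theta_exp_gt0 i : 0 < theta_of H ^ i.
Proof. by rewrite exprz_gt0// theta_of_gt0. Qed.

Lemma mpow_add i x y z : mpow H i x -> mpow H i y -> (x +h y) z -> mpow H i z.
Proof.
rewrite !mpowE => xi yi /(@hval_ultra K H) /le_trans; apply.
by rewrite ge_max xi.
Qed.

Lemma mpow_opp i x : mpow H i x -> mpow H i (hopp x).
Proof. by rewrite !mpowE hvalN. Qed.

Lemma mpow_mul i j x y : mpow H i x -> mpow H j y -> mpow H (i + j) (x *h y).
Proof.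
rewrite !mpowE hvalM => xi yj; rewrite expfzDr ?gt_eqF ?theta_of_gt0//.
by apply: ler_pM; rewrite ?hval_ge0.
Qed.

Lemma tclassD i x y z : mpow H i x -> mpow H i y -> (x +h y) z ->
  tclass i z = tadd (tclass i x) (tclass i y).
Proof.
move=> xi yi xyz; rewrite /tadd.
set x' := tlift (tclass i x); set y' := tlift (tclass i y).
have x'i : mpow H i x' by exact: tlift_mpow.
have y'i : mpow H i y' by exact: tlift_mpow.
have h : (x' +h y') (xget hzero (x' +h y')).
  by have [t xt] := hadd_neq0 x' y'; apply: xgetPex; exists t.
apply/tclass_eq; [exact: mpow_add xyz|exact: mpow_add h|].
have [s s1 s2] := hadd_shift x' xyz; rewrite haddC in s1.
have [t t1 t2] := hadd_shift y' s1; rewrite haddC in t1.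
apply: (@hdist_ultra _ _ s).
  by apply: le_trans s2 _; rewrite hdistC tlift_tclass.
apply: (@hdist_ultra _ _ t).
  by apply: le_trans t2 _; rewrite hdistC tlift_tclass.
apply: le_trans (hadd_diam t1 h) _.
rewrite ler_wpM2l ?rho_of_ge0// ge_max -!mpowE.
by rewrite x'i y'i.
Qed.

Lemma tclassN i x : mpow H i x -> tclass i (hopp x) = topp (tclass i x).
Proof.
move=> xi; apply/tclass_eq; rewrite ?mpow_opp ?tlift_mpow//.
have [z xz E] := hdist_ex (tlift (tclass i x)) x.
have := tlift_tclass xi; rewrite E; apply: le_trans; apply: hdist_le.
by rewrite hoppK haddC.
Qed.

Lemma tclassM i j x y : mpow H i x -> mpow H j y ->
  tclass (i + j) (x *h y) = tmul (tclass i x) (tclass j y).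
Proof.
move=> xi yj; rewrite /tmul.
set x' := tlift (tclass i x); set y' := tlift (tclass j y).
have x'i : mpow H i x' by exact: tlift_mpow.
have y'j : mpow H j y' by exact: tlift_mpow.
apply/tclass_eq; rewrite ?mpow_mul// expfzDr ?gt_eqF ?theta_of_gt0// mulrA.
apply: (@hdist_ultra _ _ (x' *h y)).
  apply: le_trans (hdistM _ _ _) _; apply: ler_pM.
  - exact: hdist_ge0.
  - exact: hval_ge0.
  - by rewrite hdistC tlift_tclass.
  - by rewrite -mpowE.
rewrite ![x' *h _]hmulC mulrAC.
apply: le_trans (hdistM _ _ _) _; apply: ler_pM.
- exact: hdist_ge0.
- exact: hval_ge0.
- by rewrite hdistC tlift_tclass.
- by rewrite -mpowE.
Qed.

Lemma taddC i : commutative (@tadd i).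
Proof.
move=> a b; have [x xi ->] := tclass_surj a; have [y yi ->] := tclass_surj b.
have [z xyz] := hadd_neq0 x y.
by rewrite -(tclassD xi yi xyz) -(@tclassD _ y x z)// haddC.
Qed.

Lemma taddA i : associative (@tadd i).
Proof.
move=> a b c; have [x xi ->] := tclass_surj a.
have [y yi ->] := tclass_surj b; have [z zi ->] := tclass_surj c.
have [u yzu] := hadd_neq0 y z; have [t xut] := hadd_neq0 x u.
have [w xyw wzt] := hadd_asso' yzu xut.
have ui := mpow_add yi zi yzu; have wi := mpow_add xi yi xyw.
rewrite -(tclassD yi zi yzu) -(tclassD xi yi xyw).
by rewrite -(tclassD xi ui xut) -(tclassD wi zi wzt).
Qed.

Lemma tadd0 i : left_id (tzero i) (@tadd i).
Proof.
move=> a; have [x xi ->] := tclass_surj a.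
by rewrite -(@tclassD _ hzero x x) ?mpow0// haddC haddx0.
Qed.

Lemma taddN i : left_inverse (tzero i) (@topp i) (@tadd i).
Proof.
move=> a; have [x xi ->] := tclass_surj a; rewrite -tclassN//.
by rewrite -(@tclassD _ (hopp x) x hzero) ?mpow_opp// haddC; exact: hsub0.
Qed.

HB.instance Definition _ i :=
  GRing.isZmodule.Build (trunc i) (@taddA i) (@taddC i) (@tadd0 i) (@taddN i).

End Truncation.

Arguments trunc {K} H i.
Arguments tclass {K H} i x.

Section TruncationRing.
Variables (K : realType) (H : discreteHyperfieldType K).
Implicit Types (x y z : H) (i j : int).

Definition trunc_ring := trunc H 0.
Definition trunc_module := trunc H 1.

HB.instance Definition _ := GRing.Zmodule.on trunc_ring.
HB.instance Definition _ := GRing.Zmodule.on trunc_module.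

Definition tmul00 (a b : trunc_ring) : trunc_ring := tmul a b.
Definition tmul01 (a : trunc_ring) (m : trunc_module) : trunc_module := tmul a m.
Definition tone : trunc_ring := tclass 0 hone.
Definition teps (m : trunc_module) : trunc_ring := tclass 0 (tlift m).

Lemma mpow1 : mpow H 0 hone.
Proof. by rewrite mpowE hval1 expr0z. Qed.

Lemma tmul00E x y : mpow H 0 x -> mpow H 0 y ->
  tmul00 (tclass 0 x) (tclass 0 y) = tclass 0 (x *h y).
Proof. by move=> x0 y0; rewrite /tmul00 -tclassM. Qed.

Lemma tmul01E x y : mpow H 0 x -> mpow H 1 y ->
  tmul01 (tclass 0 x) (tclass 1 y) = tclass 1 (x *h y).
Proof. by move=> x0 y0; rewrite /tmul01 -tclassM. Qed.

Lemma mpow00 x y : mpow H 0 x -> mpow H 0 y -> mpow H 0 (x *h y).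
Proof. by move=> x0 /(mpow_mul x0); rewrite addr0. Qed.

Lemma mpow01 x y : mpow H 0 x -> mpow H 1 y -> mpow H 1 (x *h y).
Proof. by move=> x0 /(mpow_mul x0); rewrite add0r. Qed.

Lemma tmul00A : associative tmul00.
Proof.
move=> a b c; have [x xi ->] := tclass_surj a.
have [y yi ->] := tclass_surj b; have [z zi ->] := tclass_surj c.
by rewrite !tmul00E ?mpow00// hmulA.
Qed.

Lemma tmul00C : commutative tmul00.
Proof.
move=> a b; have [x xi ->] := tclass_surj a; have [y yi ->] := tclass_surj b.
by rewrite !tmul00E// hmulC.
Qed.

Lemma tmul001 : left_id tone tmul00.
Proof.
move=> a; have [x xi ->] := tclass_surj a.
by rewrite /tone tmul00E ?mpow1// hmul1x.
Qed.

Lemma tmul00Dl : left_distributive tmul00 +%R.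
Proof.
move=> a b c; have [x xi ->] := tclass_surj a.
have [y yi ->] := tclass_surj b; have [z zi ->] := tclass_surj c.
have [t xyt] := hadd_neq0 x y; have ti := mpow_add xi yi xyt.
rewrite -[_ + _](tclassD xi yi xyt) !tmul00E//.
by apply: tclassD; rewrite ?mpow00//; apply: hmulDl_sub; exists t.
Qed.

Lemma tone_neq0 : tone != 0.
Proof.
apply/eqP => /tclass_eq; rewrite mpow1 mpow0 hdistx0 hval1 expr0z mulr1.
by move=> /(_ isT isT); rewrite leNgt rho_of_lt1.
Qed.

HB.instance Definition _ := GRing.Zmodule_isComNzRing.Build trunc_ring
  tmul00A tmul00C tmul001 tmul00Dl tone_neq0.

Lemma tmul01A (a b : trunc_ring) (m : trunc_module) :
  tmul01 a (tmul01 b m) = tmul01 (a * b) m.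
Proof.
have [x xi ->] := tclass_surj a; have [y yi ->] := tclass_surj b.
have [z zi ->] := tclass_surj m.
by rewrite [_ * _]tmul00E// !tmul01E ?mpow00 ?mpow01// hmulA.
Qed.

Lemma tmul011 : left_id 1 tmul01.
Proof.
move=> m; have [x xi ->] := tclass_surj m.
by rewrite -[1]/tone /tone tmul01E ?mpow1// hmul1x.
Qed.

Lemma tmul01Dr : right_distributive tmul01 +%R.
Proof.
move=> a m n; have [x xi ->] := tclass_surj a.
have [y yi ->] := tclass_surj m; have [z zi ->] := tclass_surj n.
have [t yzt] := hadd_neq0 y z; have ti := mpow_add yi zi yzt.
rewrite -[_ + _](tclassD yi zi yzt) !tmul01E//.
apply: tclassD; rewrite ?mpow01// ![x *h _]hmulC.
by apply: hmulDl_sub; exists t.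
Qed.

Lemma tmul01Dl (m : trunc_module) : {morph tmul01^~ m : a b / a + b}.
Proof.
move=> a b; have [x xi ->] := tclass_surj a.
have [y yi ->] := tclass_surj b; have [z zi ->] := tclass_surj m.
have [t xyt] := hadd_neq0 x y; have ti := mpow_add xi yi xyt.
rewrite -[_ + _](tclassD xi yi xyt) !tmul01E//.
by apply: tclassD; rewrite ?mpow01//; apply: hmulDl_sub; exists t.
Qed.

HB.instance Definition _ := GRing.Zmodule_isLmodule.Build trunc_ring
  trunc_module tmul01A tmul011 tmul01Dr tmul01Dl.

(* Independence of the lift chosen in [teps]. *)
Lemma tepsE x : mpow H 1 x -> teps (tclass 1 x) = tclass 0 x.
Proof.
move=> x1; have [_ _ [_ [t1 _]]] := theta_ofP H.
have h y : mpow H 1 y -> mpow H 0 y.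
  by rewrite !mpowE expr1z expr0z => /le_trans; apply; exact: ltW.
apply/tclass_eq; [exact/h/tlift_mpow|exact: h|].
apply: le_trans (tlift_tclass x1) _.
by rewrite ler_wpM2l ?rho_of_ge0// expr1z expr0z ltW.
Qed.

End TruncationRing.

Arguments trunc_ring {K} H.
Arguments trunc_module {K} H.
Arguments teps {K H} m.

Section Ideals.
Variable R : comNzRingType.
Implicit Types I J : set R.

Definition ideal I : Prop :=
  [/\ I 0, forall a b, I a -> I b -> I (a + b) & forall r a, I a -> I (r * a)].

Definition maximal_ideal I : Prop :=
  [/\ ideal I, I <> setT & forall J, ideal J -> I `<=` J -> J = I \/ J = setT].

Definition local_ring : Prop := exists! I, maximal_ideal I.

Definition artinian : Prop := forall I : nat -> set R,
  (forall n, ideal (I n)) -> (forall n, I n.+1 `<=` I n) ->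
  exists N, forall n, (N <= n)%N -> I n = I N.

Definition principal_ideal I : Prop := exists a, I = range (fun r => r * a).

Definition truncated_DVR : Prop :=
  [/\ local_ring, artinian & forall I, maximal_ideal I -> principal_ideal I].

Definition free_of_rank (n : nat) (M : lmodType R) : Prop :=
  exists e : 'I_n -> M,
    forall m : M, exists! c : {ffun 'I_n -> R}, m = \sum_i c i *: e i.

End Ideals.

Record pretriple := Pretriple {
  tr_ring : comNzRingType;
  tr_module : lmodType tr_ring;
  tr_map : tr_module -> tr_ring
}.

Definition is_triple (T : pretriple) : Prop :=
  [/\ truncated_DVR (tr_ring T),
      free_of_rank 1 (tr_module T),
      scalar (@tr_map T)
    & maximal_ideal (range (@tr_map T))].

Definition Tr (K : realType) (H : discreteHyperfieldType K) : pretriple :=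
  @Pretriple (trunc_ring H) (trunc_module H) teps.

(* Main.v *)
(** The nonzero values of [H] are the powers of [theta_of H], so every element
    of [O_H] is a product of an element of value 1 and a power of a uniformizer
    [w].  Hence every element of [R] is a unit times a power of [p], the class
    of [w], and [p] is nilpotent because [rho_of H > 0].  In such a ring the
    ideals are the [(p ^ k)], which makes it a truncated DVR with maximal ideal
    [(p)].  The class of [w] in [M] is a basis of [M], and [teps] maps it to
    [p]. *)
Require Import Defs.
From mathcomp Require Import all_boot all_order all_algebra.
From mathcomp Require Import boolp classical_sets reals topology normedtype sequences.

Set Implicit Arguments.
Unset Strict Implicit.
Unset Printing Implicit Defensive.

Import Order.TTheory GRing.Theory Num.Theory.
Import numFieldNormedType.Exports.
Local Open Scope classical_set_scope.
Local Open Scope ring_scope.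

(** * Rings whose elements are units times powers of a nilpotent [p] *)

Section NilpotentUniformizer.
Variables (R : comNzRingType) (p : R) (N : nat).
Hypothesis pN0 : p ^+ N = 0.
Hypothesis unit_pow : forall a : R,
  exists u u' k, u * u' = 1 /\ a = u * p ^+ k.

Let pgen k : set R := range (fun r => r * p ^+ k).

Lemma ideal_range_mulr (a : R) : ideal (range (fun r => r * a)).
Proof.
split; first by exists 0 => //; rewrite mul0r.
- by move=> _ _ [r _ <-] [s _ <-]; exists (r + s) => //; rewrite mulrDl.
- by move=> s _ [r _ <-]; exists (s * r) => //; rewrite mulrA.
Qed.

(** Take the least [k] with [p ^+ k] in [I]; it is at most [N] since [p ^+ N = 0] lies in [I].
    Cancelling the unit in [a = u * p ^+ j] puts [p ^+ j] in [I], so [k <= j] and [a] is a multiple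
    of [p ^+ k]. *)
Lemma ideal_uniformizer_pow (I : set R) : ideal I ->
  exists2 k, (k <= N)%N & I = range (fun r => r * p ^+ k).
Proof.
move=> [I0 ID IM]; have IN : `[< I (p ^+ N) >] by rewrite pN0; apply/asboolP.
have exk : exists k, `[< I (p ^+ k) >] by exists N.
case: (ex_minnP exk) => k /asboolP Ik kmin; exists k; first exact: kmin.
apply/seteqP; split=> [a Ia|_ [r _ <-]]; last exact: IM.
have [u [u' [j [uu' aE]]]] := unit_pow a.
have kj : (k <= j)%N.
  apply: kmin; apply/asboolP.
  have -> : p ^+ j = u' * a by rewrite aE mulrA [u' * u]mulrC uu' mul1r.
  exact: IM.
by exists (u * p ^+ (j - k)) => //=; rewrite -mulrA -exprD subnK.
Qed.

(** The exponents occurring along the chain are bounded by [N]. Where the largest one is attained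
    the ideal is smallest, so the chain stops there. *)
Lemma artinian_uniformizer : artinian R.
Proof.
move=> I Iid Idec.
have Isub m n : (m <= n)%N -> I n `<=` I m.
  move=> /subnK <-; elim: (n - m)%N => // d IH.
  by apply: subset_trans IH; exact: Idec.
pose P k := `[< (k <= N)%N /\ exists n, I n = pgen k >].
have exP : exists k, P k.
  have [k kN Ik] := ideal_uniformizer_pow (Iid 0%N).
  by exists k; apply/asboolP; split=> //; exists 0%N.
have boundP k : P k -> (k <= N)%N by move=> /asboolP[].
case: (ex_maxnP exP boundP) => k /asboolP[_ [m Im]] kmax; exists m => n mn.
apply/seteqP; split; first exact: Isub.
have [j jN In] := ideal_uniformizer_pow (Iid n).
have jk : (j <= k)%N by apply: kmax; apply/asboolP; split=> //; exists n.
rewrite Im In => _ [r _ <-]; exists (r * p ^+ (k - j)) => //.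
by rewrite -mulrA -exprD subnK.
Qed.

Lemma uniformizer_ideal_proper : range (fun r => r * p) <> [set: R].
Proof.
move=> pT; have : range (fun r => r * p) 1 by rewrite pT.
(* If [r * p = 1], then [1 = (r * p) ^+ N = 0] by nilpotency. *)
case=> r _ rp1; have := expr1n R N.
by rewrite -rp1 exprMn pN0 mulr0 => /eqP; rewrite eq_sym rp1 oner_eq0.
Qed.

Lemma ideal_sub_uniformizer (I : set R) : ideal I ->
  I = setT \/ I `<=` range (fun r => r * p).
Proof.
move=> /ideal_uniformizer_pow[[|k] _ ->]; [left|right].
  by apply/seteqP; split=> // a _; exists a => //; rewrite expr0 mulr1.
by move=> _ [r _ <-]; exists (r * p ^+ k) => //; rewrite exprSr mulrA.
Qed.

Lemma maximal_ideal_uniformizer : maximal_ideal (range (fun r => r * p)).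
Proof.
split; [exact: ideal_range_mulr|exact: uniformizer_ideal_proper|].
move=> J Jid pJ; have [->|Jp] := ideal_sub_uniformizer Jid; first by right.
by left; apply/seteqP.
Qed.

Lemma maximal_ideal_uniformizer_unique (I : set R) : maximal_ideal I ->
  I = range (fun r => r * p).
Proof.
move=> [Iid IT Imax]; have [//|Ip] := ideal_sub_uniformizer Iid.
have [->//|] := Imax _ (ideal_range_mulr p) Ip.
by move/uniformizer_ideal_proper.
Qed.

Lemma truncated_DVR_uniformizer : truncated_DVR R.
Proof.
split; last by move=> I /maximal_ideal_uniformizer_unique ->; exists p.
- exists (range (fun r => r * p)); split; first exact: maximal_ideal_uniformizer.
  by move=> I /maximal_ideal_uniformizer_unique.
- exact: artinian_uniformizer.
Qed.

End NilpotentUniformizer.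

(** * Powers of the uniformizer and linearity of [teps] *)

Section Uniformizer.
Variables (K : realType) (H : discreteHyperfieldType K).
Implicit Types (x y : H) (a : trunc_ring H) (m : trunc_module H).
Local Notation hv := (hval : H -> K).

Lemma theta_of_lt1 : theta_of H < 1.
Proof. by have [? _ [_ []]] := theta_ofP H. Qed.

Lemma theta_pow_small (e : K) : 0 < e -> exists n : nat, theta_of H ^+ n <= e.
Proof.
move=> e0; have t0 := theta_of_gt0 H.
have := @cvg_expr K (theta_of H); rewrite gtr0_norm// => /(_ theta_of_lt1).
move=> /cvgrPdist_le /(_ _ e0) [n _ /(_ n (leqnn n))] /=.
by rewrite sub0r normrN gtr0_norm ?exprn_gt0//; exists n.
Qed.

(** Induction on [n] with [theta_of H ^+ n <= hv x]. A value below 1 is at most [theta_of H], so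
    dividing by a uniformizer keeps it at most 1 and lowers [n] by one. *)
Lemma hval_theta_pow x : x <> hzero -> hv x <= 1 ->
  exists k : nat, hv x = theta_of H ^+ k.
Proof.
move=> x0 x1; have t0 := theta_of_gt0 H.
have [w w0 [wE [_ wmax]]] := theta_ofP H.
have [w' w'0 w'E] := hval_inv w0; rewrite wE in w'E.
have [n nx] := theta_pow_small (hval_gt0 x0).
elim: n x x0 x1 nx => [|n IH] x x0 x1 nx.
  by exists 0%N; apply/eqP; rewrite eq_le x1.
have [xlt|xge] := ltP (hv x) 1; last first.
  by exists 0%N; apply/eqP; rewrite eq_le x1.
have xt := wmax _ x0 xlt.
have [||k kE] := IH _ (hmul_neq0 x0 w'0); rewrite ?hvalM ?w'E.
- by rewrite ler_pdivrMr ?mul1r.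
- by rewrite ler_pdivlMr// -exprSr.
by exists k.+1; rewrite exprSr -kE hvalM w'E divfK ?gt_eqF.
Qed.

Lemma tclass_eq0 i x : mpow H i x ->
  tclass i x = 0 <-> hv x <= rho_of H * theta_of H ^ i.
Proof. by move=> xi; rewrite -hdistx0; apply: tclass_eq => //; exact: mpow0. Qed.

Lemma exists_uniformizer : exists w w' : H,
  [/\ hv w = theta_of H, hv w' = (theta_of H)^-1 & w *h w' = hone].
Proof.
have [w w0 [wE _]] := theta_ofP H; have [w' ww'] := hinv_exists _ w0.
exists w, w'; split=> //; have tn0 := gt_eqF (theta_of_gt0 H).
apply: (mulfI (negbT tn0)); rewrite mulfV ?tn0//.
by rewrite -[in LHS]wE -hvalM ww' hval1.
Qed.

Lemma tclass_pow w k : mpow H 0 w ->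
  (tclass 0 w : trunc_ring H) ^+ k = tclass 0 (iter k (hmul w) hone).
Proof.
move=> w0; elim: k => [|k IH]; first by rewrite expr0.
have wk : mpow H 0 (iter k (hmul w) hone).
  by elim: k {IH} => [|k IH]; [exact: mpow1|exact: mpow00].
by rewrite exprS IH [LHS]tmul00E.
Qed.

Lemma hval_iter_mul w k : hv (iter k (hmul w) hone) = hv w ^+ k.
Proof.
by elim: k => [|k IH]; rewrite ?expr0 ?hval1//= hvalM IH exprS.
Qed.

Lemma teps_linear : scalar (@teps K H).
Proof.
have sub x : mpow H 1 x -> mpow H 0 x.
  by rewrite !mpowE expr1z expr0z => /le_trans; apply; exact/ltW/theta_of_lt1.
move=> a m n; have [x xi ->] := tclass_surj a.
have [y yi ->] := tclass_surj m; have [z zi ->] := tclass_surj n.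
(* A single element [t] of the hypersum represents the sum both in [M] and in [R]. *)
have xyi := mpow01 xi yi; have [t tE] := hadd_neq0 (x *h y) z.
have ti := mpow_add xyi zi tE.
have -> : (tclass 0 x : trunc_ring H) *: (tclass 1 y : trunc_module H)
    + tclass 1 z = tclass 1 t.
  by rewrite [_ *: _]tmul01E//; symmetry; exact: tclassD.
rewrite (tepsE ti) (tepsE yi) (tepsE zi) [_ * _](tmul00E xi (sub _ yi)).
by apply: tclassD => //; exact: sub.
Qed.

End Uniformizer.

(** * The components of the triple in terms of [w] *)

Section Triple.
Variables (K : realType) (H : discreteHyperfieldType K) (w w' : H).
Hypotheses (wE : hval w = theta_of H :> K)
  (w'E : hval w' = (theta_of H)^-1 :> K) (ww' : w *h w' = hone).
Local Notation hv := (hval : H -> K).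

Let p : trunc_ring H := tclass 0 w.
Let e : trunc_module H := tclass 1 w.

Let w_in0 : mpow H 0 w.
Proof. by rewrite mpowE wE expr0z; exact/ltW/theta_of_lt1. Qed.

Let w_in1 : mpow H 1 w.
Proof. by rewrite mpowE wE expr1z. Qed.

(** Two elements of [O_H] at distance at most [rho_of H] have the same class in [R], and the value
    of a high power of [w] drops below [rho_of H]. *)
Lemma uniformizer_nilpotent : exists N, p ^+ N = 0.
Proof.
have [r0 _ _ _] := rho_ofP H; have [N tN] := theta_pow_small H r0; exists N.
rewrite [LHS]tclass_pow//; apply/tclass_eq0.
  by rewrite mpowE expr0z hval_iter_mul wE exprn_ile1 ?theta_of_ge0// ltW ?theta_of_lt1.
by rewrite expr0z mulr1 hval_iter_mul wE.
Qed.

Lemma trunc_unit_pow (a : trunc_ring H) :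
  exists u u' k, u * u' = 1 /\ a = u * p ^+ k.
Proof.
have [x xi ->] := tclass_surj a; rewrite mpowE expr0z in xi.
have [->|/eqP x0] := eqVneq x hzero.
  have [N pN] := uniformizer_nilpotent.
  (* The zero class is the unit 1 times the vanishing power of [p]. *)
  by exists 1, 1, N; rewrite mulr1 pN mulr0.
have [k kE] := hval_theta_pow x0 xi.
have tk0 : theta_of H ^+ k != 0 by rewrite expf_neq0// gt_eqF ?theta_of_gt0.
pose wk := iter k (hmul w) hone; pose wk' := iter k (hmul w') hone.
have wkK : wk *h wk' = hone.
  rewrite /wk /wk'; elim: (k) => [|j IH] /=; first by rewrite hmul1x.
  by rewrite -hmulA [_ *h (w' *h _)]hmulC -hmulA [_ *h iter j (hmul w) _]hmulC
    IH [w' *h _]hmulC hmul1x.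
(* Dividing [x] by [w] to the power [k] leaves value 1; the inverse then also has value 1, so both
   have classes in [R]. *)
pose y := x *h wk'.
have y1 : hv y = 1 by rewrite hvalM hval_iter_mul w'E kE exprVn divff.
have y0 : y <> hzero.
  by move=> y0; have := oner_neq0 K; rewrite -y1 y0 hval0 eqxx.
have [z yz] := hinv_exists _ y0.
have z1 : hv z = 1 by rewrite -[hv z]mul1r -y1 -hvalM yz hval1.
have yi : mpow H 0 y by rewrite mpowE y1 expr0z.
have zi : mpow H 0 z by rewrite mpowE z1 expr0z.
exists (tclass 0 y), (tclass 0 z), k; split.
  by rewrite [LHS]tmul00E// yz.
rewrite /p tclass_pow// [RHS]tmul00E//.
  by rewrite -hmulA [wk' *h _]hmulC wkK hmulC hmul1x.
by rewrite mpowE expr0z hval_iter_mul wE -kE.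
Qed.

(** Dividing a lift in [m_H] by [w] lands in [O_H]. *)
Lemma trunc_module_basis (m : trunc_module H) : exists c : trunc_ring H, m = c *: e.
Proof.
have [y yi ->] := tclass_surj m; exists (tclass 0 (y *h w')).
rewrite [RHS]tmul01E//; first by rewrite -hmulA [w' *h _]hmulC ww' hmulC hmul1x.
rewrite mpowE expr0z hvalM w'E ler_pdivrMr ?theta_of_gt0// mul1r.
by move: yi; rewrite mpowE expr1z.
Qed.

(** Multiplication by [w] scales values by [theta_of H], exactly the ratio between the radii of the
    equivalences defining [M] and [R]. *)
Lemma trunc_module_torsion_free (c : trunc_ring H) : c *: e = 0 -> c = 0.
Proof.
have [x xi ->] := tclass_surj c.
rewrite [_ *: _]tmul01E// => /(tclass_eq0 (mpow01 xi w_in1)).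
rewrite hvalM wE expr1z ler_pM2r ?theta_of_gt0// => xr.
by apply/tclass_eq0; rewrite // expr0z mulr1.
Qed.

Lemma free_trunc_module : free_of_rank 1 (trunc_module H).
Proof.
exists (fun=> e) => m; have [c mE] := trunc_module_basis m.
exists [ffun=> c]; split=> [|d]; first by rewrite big_ord1 ffunE.
rewrite big_ord1 mE => /eqP; rewrite -subr_eq0 -scalerBl => /eqP.
move=> /trunc_module_torsion_free /eqP; rewrite subr_eq0 => /eqP cd.
by apply/ffunP => i; rewrite ffunE (ord1 i).
Qed.

Lemma range_teps : range (@teps K H) = range (fun r => r * p).
Proof.
have epsE c : teps (c *: e) = c * p.
  have teps0 : teps (0 : trunc_module H) = 0.
    by rewrite [LHS](tepsE (mpow0 H 1)).
  (* Linearity is stated for [a *: u + v]; taking [v = 0] isolates the scalar part. Then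
     [teps e = p], as both are classes of [w]. *)
  have := teps_linear c e 0; rewrite teps0 !addr0 => ->.
  by rewrite (tepsE w_in1).
apply/seteqP; split=> [_ [m _ <-]|_ [c _ <-]].
  by have [c ->] := trunc_module_basis m; exists c.
by exists (c *: e).
Qed.

Lemma is_triple_uniformizer : is_triple (Tr H).
Proof.
have [N pN] := uniformizer_nilpotent; split.
- exact: truncated_DVR_uniformizer pN trunc_unit_pow.
- exact: free_trunc_module.
- exact: teps_linear.
- rewrite [X in maximal_ideal X]range_teps.
  exact: maximal_ideal_uniformizer pN trunc_unit_pow.
Qed.

End Triple.

Theorem theorem4p8 (K : realType) (H : discreteHyperfieldType K)
    (H_not_field : ~ hyperfield_is_field H) :
  is_triple (Tr H).
Proof.
have [w [w' [wE w'E ww']]] := exists_uniformizer H.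
exact: is_triple_uniformizer wE w'E ww'.
Qed.
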